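(* Let $a\geq b$ be positive integers and let $G=(A,B,E)$ be an $(a,b)$--biregular bipartite graph on $v(G)$ vertices, i.e. every vertex of $A$ has degree $a$ and every vertex of $B$ has degree $b$ (so $|A|\leq|B|$). Let $0\leq k\leq |A|$ be an integer, let $m_k(G)$ denote the number of matchings of size $k$, let $p=\frac{2k}{v(G)}$ and $q=\frac{a+b}{2b}p$, and let $$p_{\mu}={|A|\choose k}q^k(1-q)^{|A|-k}$$ be the probability that a Binomial$(|A|,q)$ random variable takes its mean value $k$. Then $$m_k(G)\geq p_{\mu}\exp\big(v(G)\cdot \mathcal{G}_{a,b}(p)\big).$$
   Context: Let $H(q)=-(q\ln q+(1-q)\ln(1-q))$ for $0\leq q\leq 1$, with $H(0)=H(1)=0$. For positive integers $a,b$ and $0\leq p\leq \min\left(\frac{2a}{a+b},\frac{2b}{a+b}\right)$, $$\mathcal{G}_{a,b}(p)=\frac{a}{a+b}H\left(\frac{a+b}{2a}p\right)+\frac{b}{a+b}H\left(\frac{a+b}{2b}p\right)+\frac{1}{2}p\ln(ab)-\frac{ab}{a+b}H\left(\frac{a+b}{2ab}p\right).$$ A matching of size $k$ is a set of $k$ pairwise vertex-disjoint edges. *)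

(* Defs.v *)
From mathcomp Require Import all_boot.
From Stdlib Require Import Reals.
Set Implicit Arguments. Unset Strict Implicit. Unset Printing Implicit Defensive.

Definition Hent (q : R) : R :=
  if Req_EM_T q 0 then 0%R else if Req_EM_T q 1 then 0%R
  else (- (q * ln q + (1 - q) * ln (1 - q)))%R.

Definition Gab (a b : nat) (p : R) : R :=
  let ra := INR a in let rb := INR b in
  (ra / (ra + rb) * Hent ((ra + rb) / (2 * ra) * p)
   + rb / (ra + rb) * Hent ((ra + rb) / (2 * rb) * p)
   + / 2 * p * ln (ra * rb)
   - ra * rb / (ra + rb) * Hent ((ra + rb) / (2 * ra * rb) * p))%R.

Definition is_matching (TA TB : finType) (E : TA -> TB -> bool)
  (M : {set TA * TB}) : bool :=
  [forall m in M, E m.1 m.2] &&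
  [forall m1 in M, forall m2 in M,
     (m1 != m2) ==> ((m1.1 != m2.1) && (m1.2 != m2.2))].

Definition num_matchings (TA TB : finType) (E : TA -> TB -> bool) (k : nat) : nat :=
  #|[set M : {set TA * TB} | is_matching E M && (#|M| == k)]|.

(* Main.v *)
(* Write n = |A|, m = |B|, l = k / m, q = k / n and M(z) = sum_j m_j z^(n-j). All
   the powers of k cancel, and the claim becomes m_k >= p_mu * D with
   D = C(l)^m * a^k / (q^k (1-q)^(n-k)), C(l) = (1 - l/b)^(b-l) / (1-l)^(1-l).
   First, M(z) >= D z^(n-k) for z > 0, by a capacity argument in the style of
   Gurvits. Let f_U be the generating polynomial, in vertex weights z_i on A, of
   the matchings covering only part of U in B. Starting from U empty and the
   weights z + sum_(u ~ i) x_u, where weighted AM-GM applies, one moves the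
   vertices u of B into U one at a time, each step costing a factor C(l). The
   univariate inequality needed, f(w + t 1_N(u)) <= f(w) (1 + t s / b)^b, follows
   from AM-GM and negative correlation (the Rayleigh property) of f_U.
   Second, the zeros of M are real (Heilmann-Lieb), so the coefficients of M are
   ultra-log-concave by Newton, and a lower bound on M(z) / z^(n-k) for all z > 0
   becomes a lower bound on m_k with the binomial factor p_mu. *)
From Stdlib Require Import Reals.
Require Import Defs.
From mathcomp Require Import all_boot all_order all_algebra all_field.
From mathcomp Require Import ring lra.
From mathcomp Require Import Rstruct.
Set Implicit Arguments. Unset Strict Implicit. Unset Printing Implicit Defensive.
Import Order.TTheory GRing.Theory Num.Theory.
Local Open Scope ring_scope.

(** * Matching partition functions *)

Section PartitionFunction.
Variables (TA TB : finType) (E : TA -> TB -> bool).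

(** The sum, over matchings between [S] and [U], of the product of [z] over the vertices of [S] left
    uncovered. *)
Fixpoint mpart (R : comNzRingType) (z : TA -> R) (U : seq TB) (S : {set TA}) : R :=
  if U is u :: U' then mpart z U' S + \sum_(i in S | E i u) mpart z U' (S :\ i)
  else \prod_(i in S) z i.

Lemma size_rem_lt (u : TB) U : u \in U -> (size (rem u U) < size U)%N.
Proof. by move=> Uu; rewrite size_rem // ltn_predL; case: U Uu. Qed.

Lemma eq_mpart (R : comNzRingType) (z z' : TA -> R) U S :
  z =1 z' -> mpart z U S = mpart z' U S.
Proof.
move=> zz'; elim: U S => [|u U IH] S /=; first by apply: eq_bigr.
by rewrite IH; congr (_ + _); apply: eq_bigr => i _; rewrite IH.
Qed.

Lemma mpart_sum2C (R : comNzRingType) (F : {set TA} -> R) (S : {set TA}) u v :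
  \sum_(i in S | E i u) \sum_(j in S :\ i | E j v) F (S :\ i :\ j) =
  \sum_(j in S | E j v) \sum_(i in S :\ j | E i u) F (S :\ j :\ i).
Proof.
rewrite (exchange_big_dep (fun j => (j \in S) && E j v)) /=; last first.
  by move=> i j _; rewrite !inE => /andP[/andP[_ ->] ->].
apply: eq_bigr => j /andP[jS jv]; apply: eq_big => i.
  by rewrite !inE jS jv eq_sym; do ?case: (_ == _); do ?case: (_ \in _); case: (E i u).
by move=> _; rewrite !setDDl setUC.
Qed.

(** Decisions about two vertices of [U] commute by [mpart_sum2C], so any vertex of [U] can play the
    part of the head. *)
Lemma mpart_rem (R : comNzRingType) (z : TA -> R) u U S : u \in U ->
  mpart z U S = mpart z (rem u U) S
    + \sum_(i in S | E i u) mpart z (rem u U) (S :\ i).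
Proof.
elim: U S => [//|v U IH] S /=; rewrite inE; case: eqVneq => [->|uv] //= uU.
rewrite !IH // !(eq_bigr _ (fun i _ => IH (S :\ i) uU)).
by rewrite !big_split /= mpart_sum2C -!addrA; congr (_ + _); rewrite addrCA.
Qed.

Lemma big_setD1_cond (R : comNzRingType) (F : TA -> R) (P : pred TA) (S : {set TA}) i :
  i \in S -> \sum_(j in S | P j) F j =
    (if P i then F i else 0) + \sum_(j in S :\ i | P j) F j.
Proof. by move=> iS; rewrite big_mkcondr (big_setD1 i) //= -big_mkcondr. Qed.

(** The dual expansion: the vertex [i] stays uncovered, at weight [z i], or is matched to a
    neighbour in [U]. *)
Lemma mpart_vertex (R : comNzRingType) (z : TA -> R) U (S : {set TA}) i : uniq U -> i \in S ->
  mpart z U S = z i * mpart z U (S :\ i)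
    + \sum_(u <- U | E i u) mpart z (rem u U) (S :\ i).
Proof.
elim: U S => [|v U IH] S /=.
  by move=> _ iS; rewrite big_nil addr0 (big_setD1 i).
move=> /andP[vU uU] iS; rewrite IH // (big_setD1_cond _ _ iS).
rewrite (eq_bigr (fun j => z i * mpart z U (S :\ i :\ j) +
   \sum_(u <- U | E i u) mpart z (rem u U) (S :\ i :\ j))); last first.
  move=> j; rewrite !inE => /andP[/andP[ji jS] jv].
  by rewrite IH ?inE 1?eq_sym ?ji // !setDDl [[set j] :|: _]setUC.
rewrite big_cons /= eqxx.
have -> : \sum_(u <- U | E i u) mpart z (if v == u then U else v :: rem u U) (S :\ i) =
   \sum_(u <- U | E i u) mpart z (rem u U) (S :\ i) + 
   \sum_(j in S :\ i | E j v) \sum_(u <- U | E i u) mpart z (rem u U) (S :\ i :\ j).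
  rewrite exchange_big -big_split /= big_seq_cond [RHS]big_seq_cond.
  apply: eq_bigr => u /andP[Uu iu].
  by case: eqVneq => // vu; rewrite vu Uu in vU.
rewrite big_split /= -mulr_sumr.
by case: ifP => _; ring.
Qed.

Lemma mpart_ge0 (R : numDomainType) (z : TA -> R) U S :
  (forall i, 0 <= z i) -> 0 <= mpart z U S.
Proof.
move=> z0; elim: U S => [|u U IH] S /=; first exact: prodr_ge0.
by rewrite addr_ge0 ?sumr_ge0.
Qed.

Lemma mpart_gt0 (R : numDomainType) (z : TA -> R) U S :
  (forall i, 0 < z i) -> 0 < mpart z U S.
Proof.
move=> z0; elim: U S => [|u U IH] S /=; first exact: prodr_gt0.
by rewrite ltr_pwDl ?sumr_ge0 // => i _; rewrite ltW.
Qed.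

(** [mpart] is affine in each single weight; its slope in [z j] is the value with [j] deleted. *)
Lemma mpart_add1 (R : comNzRingType) (z z' : TA -> R) t U (S : {set TA}) j :
  (forall i, i != j -> z' i = z i) -> z' j = z j + t ->
  mpart z' U S = mpart z U S + (if j \in S then t * mpart z U (S :\ j) else 0).
Proof.
move=> zz' zj; elim: U S => [|u U IH] S /=.
  case: ifP => jS; last first.
    rewrite addr0; apply: eq_bigr => i iS; rewrite zz' //.
    by apply: contraFneq jS => <-.
  rewrite !(big_setD1 j jS) /= zj mulrDl; congr (_ * _ + _ * _);
  by apply: eq_bigr => i; rewrite !inE => /andP[ij _]; rewrite zz'.
rewrite IH (eq_bigr _ (fun i _ => IH (S :\ i))) big_split /= -!addrA; congr (_ + _).
rewrite addrCA; congr (_ + _); case: ifP => jS; last first.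
  by rewrite add0r big1 // => i _; rewrite !inE jS andbF.
rewrite mulrDr; congr (_ + _); rewrite mulr_sumr (big_setD1_cond _ _ jS).
rewrite !inE eqxx /= if_same add0r; apply: eq_bigr => i.
rewrite !inE jS => /andP[/andP[ij iS] _]; rewrite eq_sym ij /= !setDDl.
by rewrite setUC.
Qed.

(* Negative correlation inside [TA] follows by expanding at a vertex of [TA] from
   positive correlation between the two sides, which follows by expanding at a
   vertex of [TB] from negative correlation in a smaller graph. The differences
   are sums of squares, so no sign condition on [z] is needed. *)
Lemma mpart_rayleigh (R : realDomainType) (z : TA -> R) U : uniq U ->
  (forall (S : {set TA}) i j, i \in S -> j \in S -> i != j ->
    mpart z U S * mpart z U (S :\ i :\ j) <= mpart z U (S :\ i) * mpart z U (S :\ j)).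
Proof.
have [n] := ubnP (size U); elim: n U => // n IHn U sU uU.
have mixed (S : {set TA}) j u : u \in U -> j \in S ->
    mpart z U (S :\ j) * mpart z (rem u U) S <= mpart z U S * mpart z (rem u U) (S :\ j).
  move=> Uu jS; rewrite !(mpart_rem _ _ Uu) (big_setD1_cond _ _ jS).
  have IH := IHn (rem u U) (leq_trans (size_rem_lt Uu) sU) (rem_uniq u uU).
  rewrite -subr_ge0; set f := mpart z _.
  rewrite (_ : _ - _ = (if E j u then f (S :\ j) else 0) * f (S :\ j) +
     \sum_(i in S :\ j | E i u) (f (S :\ i) * f (S :\ j) - f S * f (S :\ j :\ i))).
    apply: addr_ge0; first by case: ifP; rewrite ?mul0r // -expr2 sqr_ge0.
    apply: sumr_ge0 => i; rewrite !inE => /andP[/andP[ij iS] _].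
    rewrite subr_ge0 [S :\ j :\ i]setDDl setUC -setDDl IH //.
  by rewrite sumrB -mulr_suml -mulr_sumr; ring.
move=> S i j iS jS ij; rewrite -subr_ge0.
have jSi : j \in S :\ i by rewrite !inE eq_sym ij.
have iSj : i \in S :\ j by rewrite !inE ij.
rewrite (mpart_vertex z uU iS) (mpart_vertex z uU iSj).
rewrite [S :\ j :\ i]setDDl [_ :|: [set i]]setUC -setDDl.
set f := mpart z U _; set g := mpart z U _.
rewrite (_ : _ - _ = \sum_(u <- U | E i u)
  (f * mpart z (rem u U) (S :\ i :\ j) - g * mpart z (rem u U) (S :\ i))); last first.
  by rewrite sumrB -!mulr_sumr; ring.
rewrite big_seq_cond; apply: sumr_ge0 => u /andP[Uu _].
by rewrite subr_ge0 mixed.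
Qed.

(** The quotient is the logarithmic derivative in [z j]; by the Rayleigh property it decreases in
    every other weight. The weights on [N] are raised one at a time. *)
Lemma mpart_ratio_anti (R : realFieldType) (z : TA -> R) t U (S : {set TA}) N j :
  uniq U -> (forall i, 0 < z i) -> 0 <= t -> {subset N <= S} -> uniq N ->
  j \in S -> j \notin N ->
  let z' i := z i + (if i \in N then t else 0) in
  mpart z' U (S :\ j) / mpart z' U S <= mpart z U (S :\ j) / mpart z U S.
Proof.
move=> uU z0 t0; elim: N => [|l N IH] /=.
  move=> _ _ jS _; rewrite le_eqVlt; apply/orP; left; apply/eqP.
  by congr (_ / _); apply: eq_mpart => i; rewrite addr0.
move=> sN /andP[lN uN] jS; rewrite inE negb_or => /andP[jl jN].
have lS : l \in S by rewrite sN ?mem_head.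
have sN' : {subset N <= S} by move=> i iN; rewrite sN // inE iN orbT.
apply: le_trans (IH sN' uN jS jN).
set z1 := fun i => z i + (if i \in N then t else 0).
set z2 := fun i => _ + _.
have E2 i : i != l -> z2 i = z1 i by move=> il; rewrite /z2 /z1 inE (negbTE il).
have El : z2 l = z1 l + t by rewrite /z2 /z1 inE eqxx (negbTE lN) addr0.
have z1p i : 0 < z1 i by rewrite /z1; case: ifP => _; rewrite ?addr0 // ltr_pwDl.
have z2p i : 0 < z2 i by rewrite /z2; case: ifP => _; rewrite ?addr0 // ltr_pwDl.
rewrite ler_pdivrMr ?mpart_gt0 // mulrAC ler_pdivlMr ?mpart_gt0 //.
rewrite !(mpart_add1 _ _ E2 El) !inE lS eq_sym jl /=.
rewrite mulrDl mulrDr [leRHS]addrC [leRHS]addrC lerD // mulrCA -mulrA ler_wpM2l //.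
rewrite mulrC mpart_rayleigh //.
Qed.

(** Raising one weight by [t] multiplies [mpart] by [1 + t * r] for the current quotient [r], and
    [mpart_ratio_anti] bounds [r] by its value at the original weights. *)
Lemma mpart_shift_le (R : realFieldType) (z : TA -> R) t U (S : {set TA}) N :
  uniq U -> (forall i, 0 < z i) -> 0 <= t -> {subset N <= S} -> uniq N ->
  mpart (fun i => z i + (if i \in N then t else 0)) U S <=
  mpart z U S * \prod_(i <- N) (1 + t * (mpart z U (S :\ i) / mpart z U S)).
Proof.
move=> uU z0 t0; elim: N => [|l N IH] /=.
  move=> _ _; rewrite big_nil mulr1 le_eqVlt; apply/orP; left; apply/eqP.
  by apply: eq_mpart => i; rewrite addr0.
move=> sN /andP[lN uN].
have lS : l \in S by rewrite sN ?mem_head.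
have sN' : {subset N <= S} by move=> i iN; rewrite sN // inE iN orbT.
set z1 := fun i => z i + (if i \in N then t else 0).
set z2 := fun i => _ + _.
have E2 i : i != l -> z2 i = z1 i by move=> il; rewrite /z2 /z1 inE (negbTE il).
have El : z2 l = z1 l + t by rewrite /z2 /z1 inE eqxx (negbTE lN) addr0.
have z1p i : 0 < z1 i by rewrite /z1; case: ifP => _; rewrite ?addr0 // ltr_pwDl.
rewrite (mpart_add1 _ _ E2 El) lS big_cons.
rewrite [leRHS]mulrCA [leRHS]mulrC (_ : _ + _ = mpart z1 U S *
  (1 + t * (mpart z1 U (S :\ l) / mpart z1 U S))); last first.
  by field; rewrite gt_eqF ?mpart_gt0.
apply: ler_pM; rewrite ?IH //.
- by rewrite mpart_ge0 // => i; rewrite ltW.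
- by rewrite addr_ge0 // mulr_ge0 // divr_ge0 ?mpart_ge0 // => i; rewrite ltW.
- by rewrite lerD2l ler_wpM2l //; exact: mpart_ratio_anti.
Qed.

(* Heilmann-Lieb: for [Im z > 0] the quotients [mpart U S / mpart U (S :\ i)]
   stay in the upper half plane. *)
Lemma mpart_stable (C : numClosedFieldType) (z : C) U S : uniq U -> 0 < 'Im z ->
  mpart (fun=> z) U S != 0.
Proof.
move=> uU z0.
(* Induction on the size of [U], then on that of [S]. Multiplying by a conjugate instead of dividing
   keeps the sign of the imaginary part. *)
suff H : forall n m U (S : {set TA}), uniq U -> (size U < n)%N -> (#|S| < m)%N ->
    mpart (fun=> z) U S != 0 /\ forall i, i \in S ->
    0 < 'Im (mpart (fun=> z) U S * (mpart (fun=> z) U (S :\ i))^*).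
  by have [] := H _ _ U S uU (ltnSn _) (ltnSn _).
elim=> // n IHn; elim=> // m IHm {}U {}S {}uU sU sS.
(* Expanding at [u] gives a squared modulus, which is real, plus terms covered by the outer
   induction hypothesis. *)
have mixed S' u : u \in U ->
    0 <= 'Im (mpart (fun=> z) (rem u U) S' * (mpart (fun=> z) U S')^*).
  move=> Uu; rewrite [X in _ * X^*](mpart_rem _ _ Uu) rmorphD mulrDr raddfD /=.
  rewrite -normCK (Creal_ImP _ _) ?add0r; last by rewrite rpredX ?normr_real.
  rewrite rmorph_sum mulr_sumr raddf_sum sumr_ge0 // => i /andP[iS _] /=.
  have [] := IHn #|S'|.+1 (rem u U) S' (rem_uniq u uU) (leq_trans (size_rem_lt Uu) sU) (ltnSn _).
  by move=> _ H; rewrite ltW // H.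
have H i : i \in S ->
    0 < 'Im (mpart (fun=> z) U S * (mpart (fun=> z) U (S :\ i))^*).
  move=> iS; rewrite (mpart_vertex _ uU iS) mulrDl raddfD /= ltr_pwDl //.
    rewrite -mulrA -normCK; set f := mpart _ _ _.
    have f0 : f != 0.
      by have [] := IHm U (S :\ i) uU sU _; rewrite // -ltnS (leq_trans _ sS) // [#|S|](cardsD1 i) iS.
    by rewrite (ImMr (rpredX 2 (normr_real f))) mulr_gt0 ?exprn_gt0 ?normr_gt0.
  rewrite mulr_suml raddf_sum big_seq_cond sumr_ge0 // => u /andP[Uu _].
  exact: mixed.
split=> //; have [->|[i iS]] := set_0Vmem S; last first.
  by apply: contraTneq (H i iS) => ->; rewrite mul0r raddf0 ltxx.
suff -> : mpart (fun=> z) U set0 = 1 by exact: oner_neq0.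
elim: (U) => [|u V IH] /=; first by rewrite big_set0.
by rewrite IH big1 ?addr0 // => i; rewrite inE.
Qed.
End PartitionFunction.

(** * Newton inequalities for matching numbers *)

Section Matchings.
Variables (TA TB : finType) (E : TA -> TB -> bool).

Lemma is_matchingP (M : {set TA * TB}) :
  reflect ((forall i u, (i, u) \in M -> E i u) /\
    (forall i u j v, (i, u) \in M -> (j, v) \in M -> i = j \/ u = v -> (i, u) = (j, v)))
    (is_matching E M).
Proof.
apply: (iffP andP) => [[/forall_inP edge /forall_inP disj]|[edge disj]].
  split=> [i u|i u j v iu jv ijuv]; first exact: edge.
  apply/eqP/negPn/negP => neq.
  have /forall_inP/(_ _ jv)/implyP/(_ neq)/andP[/eqP ij /eqP uv] := disj _ iu.
  by case: ijuv.
split; apply/forall_inP => -[i u] iu; first exact: edge.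
apply/forall_inP => -[j v] jv; apply/implyP; apply: contraR.
by rewrite negb_and !negbK => /orP[] /eqP /= ij; apply/eqP/disj => //; [left|right].
Qed.

Lemma is_matching_add (M : {set TA * TB}) i u :
  (forall j v, (j, v) \in M -> j != i /\ v != u) ->
  is_matching E ((i, u) |: M) = E i u && is_matching E M.
Proof.
move=> Miu; apply/is_matchingP/andP => [[edge disj]|[Eiu /is_matchingP[edge disj]]].
  split; first by rewrite edge ?setU11.
  apply/is_matchingP; split=> [j v jv|j v j' v' jv jv']; first by rewrite edge ?setU1r.
  by apply: disj; rewrite setU1r.
split=> [j v|j v j' v']; rewrite !inE; first by case/orP => [/eqP[-> ->]//|/edge].
case/orP => [/eqP[-> ->]|jv]; case/orP => [/eqP[-> ->]|jv'] //; last exact: disj.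
  by have [/eqP ? /eqP ?] := Miu _ _ jv'; case=> ?; congruence.
by have [/eqP ? /eqP ?] := Miu _ _ jv; case=> ?; congruence.
Qed.

Definition matchings_in (U : seq TB) (S : {set TA}) :=
  [set M | is_matching E M & M \subset setX S [set u in U]].

(** The matchings are split by whether the head [u] is covered; deleting the edge at [u] reindexes
    those that cover it. *)
Lemma mpart_matchings (R : comNzRingType) (z : R) U S : uniq U ->
  mpart E (fun=> z) U S = \sum_(M in matchings_in U S) z ^+ (#|S| - #|M|).
Proof.
elim: U S => [|u U IH] S /=.
  move=> _; rewrite prodr_const (big_pred1 set0) ?cards0 ?subn0 // => M.
  have U0 : [set u in ([::] : seq TB)] = set0 by apply/setP => u; rewrite !inE.
  rewrite !inE U0; apply/andP/eqP => [[_]|->].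
    move=> /subsetP sM; apply/setP => -[i u]; rewrite inE; apply/negP => /sM.
    by rewrite !inE andbF.
  by rewrite sub0set; split=> //; apply/is_matchingP; split=> i u; rewrite ?inE // => j v; rewrite inE.
move=> /andP[uU uqU]; rewrite (bigID (fun M : {set _} => [exists i, (i, u) \in M])) /= addrC.
congr (_ + _).
  rewrite IH //; apply: eq_bigl => M; rewrite !inE -andbA; congr (_ && _).
  apply/subsetP/andP => [sM|[/subsetP sM /existsPn uM] [i v] iv].
    split; last by apply/existsPn => i; apply/negP => /sM; rewrite !inE (negbTE uU) andbF.
    by apply/subsetP => -[i v] /sM; rewrite !inE => /andP[-> ->]; rewrite orbT.
  have := sM _ iv; rewrite !inE => /andP[-> /=] /predU1P[vu|//].
  by have := uM i; rewrite -vu iv.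
rewrite (eq_bigr (fun M : {set _} => \sum_(i | (i, u) \in M) z ^+ (#|S| - #|M|))); last first.
  move=> M; rewrite !inE => /andP[/andP[/is_matchingP[_ disj] _] /existsP[i iu]].
  rewrite (big_pred1 i) // => j; apply/idP/eqP => [ju|->//].
  by have [] := disj _ _ _ _ ju iu (or_intror erefl).
rewrite (exchange_big_dep (fun i => (i \in S) && E i u)) /=; last first.
  move=> M i; rewrite !inE => /andP[/andP[/is_matchingP[edge _] /subsetP sM] _] iu.
  by rewrite edge //; have := sM _ iu; rewrite !inE => /andP[->].
apply: eq_bigr => i /andP[iS iu].
rewrite IH // [RHS](reindex_onto (fun M => (i, u) |: M) (fun M => M :\ (i, u))) /=; last first.
  by move=> M /andP[_ iuM]; rewrite setD1K.
have key (M : {set TA * TB}) : M \in matchings_in U (S :\ i) -> forall j v, (j, v) \in M -> j != i /\ v != u.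
  rewrite inE => /andP[_ /subsetP sM] j v /sM; rewrite !inE => /andP[/andP[-> _] vU].
  by split=> //; apply: contraNneq uU => <-.
apply: eq_big => M.
  apply/idP/idP => [MU|].
    have Miu := key _ MU; move: MU; rewrite !inE is_matching_add // iu /= eqxx /=.
    move=> /andP[-> sM] /=; have iuM : (i, u) \notin M by apply/negP => /Miu[]; rewrite eqxx.
    rewrite setU1K // eqxx !andbT; apply/andP; split; last by apply/existsP; exists i; rewrite setU11.
    rewrite subUset sub1set !inE iS eqxx /=; apply: subset_trans sM _.
    by apply/subsetP => -[j v]; rewrite !inE => /andP[/andP[_ ->] ->]; rewrite orbT.
  move=> /andP[/andP[/andP[]]]; rewrite inE => /andP[/is_matchingP[edge disj] /subsetP sM] _ _ /eqP DM.
  rewrite inE -DM; apply/andP; split.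
    apply/is_matchingP; split=> [j v|j v j' v']; rewrite !inE => /andP[_]; first by move=> jv; rewrite edge ?inE.
    by move=> jv /andP[_ jv']; apply: disj; rewrite !inE.
  apply/subsetP => -[j v]; rewrite [in X in X -> _]inE => /andP[/[!inE] neq]; rewrite -in_setU1 => jv.
  have iuM : (i, u) \in (i, u) |: M by rewrite setU11.
  have := sM _ jv; rewrite !inE => /andP[-> /= vU].
  have ji : j != i by apply: contraNneq neq => ji; apply/eqP/disj => //; left.
  have vu : v != u by apply: contraNneq neq => vu; apply/eqP/disj => //; right.
  by rewrite ji; case/predU1P: vU vu => [->|->]; rewrite ?eqxx.
move=> MU; have Miu := key _ MU; congr (_ ^+ _).
rewrite cardsU1 (cardsD1 i S) iS (_ : _ \notin _) ?subSS //.
by apply/negP => /Miu[]; rewrite eqxx.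
Qed.

Lemma card_matching (M : {set TA * TB}) : is_matching E M -> (#|M| <= #|TA|)%N.
Proof.
move=> /is_matchingP[_ disj]; rewrite -(@card_in_imset _ _ fst) ?max_card //.
by move=> [i u] [j v] iu jv /= ij; apply: disj => //; left.
Qed.

Lemma mpart_num_matchings (R : comNzRingType) (z : R) :
  mpart E (fun=> z) (enum TB) setT =
  \sum_(k < #|TA|.+1) (num_matchings E k)%:R * z ^+ (#|TA| - k).
Proof.
rewrite mpart_matchings ?enum_uniq // cardsT.
(* By [card_matching], [inord] does not alter the size of a matching. *)
rewrite (partition_big (fun M : {set TA * TB} => inord #|M| : 'I_#|TA|.+1) xpredT) //=.
apply: eq_bigr => k _; rewrite /num_matchings -[#|[set _ | _]|]sum1_card natr_sum mulr_suml.
apply: eq_big => M.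
  rewrite !inE -andbA; case: (boolP (is_matching E M)) => //= MM.
  have -> : M \subset setX setT [set u in enum TB].
    by apply/subsetP => -[i u] _; rewrite !inE mem_enum.
  by rewrite -val_eqE /= inordK // ltnS card_matching.
by rewrite mul1r !inE => /andP[/andP[MM _] /eqP <-]; rewrite inordK // ltnS card_matching.
Qed.
End Matchings.

(** Induction on the factors, for the coefficients divided by binomials. The positivity clause
    excludes internal zeros and allows cancellation in the inductive step. *)
Lemma Newton_prod_XaddC (F : numFieldType) (r : seq F) : {in r, forall x, 0 <= x} ->
  exists p : nat -> F, [/\ forall j, 0 <= p j,
    forall j, (\prod_(x <- r) ('X + x%:P))`_j = 'C(size r, j)%:R * p j,
    forall j, (j < size r)%N -> 0 < p j -> 0 < p j.+1 &
    forall j, (j.+2 <= size r)%N -> p j * p j.+2 <= p j.+1 ^+ 2].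
Proof.
elim: r => [|x r IH] r0.
  exists (fun j => (j == 0)%:R); split=> // j.
  by rewrite big_nil coef1 bin0n; case: j => [|j]; rewrite ?mulr1 ?mul0r.
have x0 : 0 <= x by rewrite r0 ?mem_head.
have r0' : {in r, forall y, 0 <= y} by move=> y yr; rewrite r0 // inE yr orbT.
have [p [p0 coefp posp newt]] := IH r0'.
set n := size r in coefp posp newt *.
(* The factors come from ['C(n, j.-1) / 'C(n.+1, j) = j / n.+1] and ['C(n, j) / 'C(n.+1, j) = (n.+1
   - j) / n.+1]. At [j = 0] the meaningless [p j.-1] is multiplied by 0. *)
pose q j := (j%:R * p j.-1 + x * (n.+1 - j)%:R * p j) / n.+1%:R.
have q0 j : 0 <= q j by rewrite divr_ge0 ?addr_ge0 ?mulr_ge0.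
have nz : n.+1%:R != 0 :> F by rewrite pnatr_eq0.
exists q; split=> //= [j|j|j jn].
- rewrite big_cons mulrDl coefD coefXM coefCM !coefp -/n /q.
  case: j => [|j] /=; first by rewrite mul0r !add0r subn0 !bin0; field; rewrite nat1r.
  have [jn|nj] := leqP j n; last first.
    by rewrite !bin_small ?(leqW nj) // !mul0r mulr0 addr0.
  have e1 : 'C(n, j)%:R = 'C(n.+1, j.+1)%:R * j.+1%:R / n.+1%:R :> F.
    by apply: (mulIf nz); rewrite divfK // -!natrM mulnC mul_bin_diag mulnC.
  have e2 : 'C(n, j.+1)%:R = 'C(n.+1, j.+1)%:R * (n - j)%:R / n.+1%:R :> F.
    by apply: (mulIf nz); rewrite divfK // -!natrM mulnC mul_bin_down mulnC subSS.
  by rewrite e1 e2 subSS; field; rewrite nat1r.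
- rewrite ltnS => jn qj.
  have pj : 0 < p j.
    move: qj; rewrite /q pmulr_lgt0 ?invr_gt0 ?ltr0Sn // => qj.
    rewrite lt_neqAle p0 andbT eq_sym; apply: contraTneq qj => pj.
    case: j pj jn => [|j] pj jn; first by rewrite pj mul0r mulr0 addr0 ltxx.
    have : ~~ (0 < p j) by apply/negP => pj'; have := posp _ jn pj'; rewrite pj ltxx.
    by rewrite lt_neqAle p0 andbT negbK eq_sym => /eqP pj'; rewrite pj /= pj' !mulr0 addr0 ltxx.
  rewrite /q divr_gt0 ?ltr0Sn // ltr_pwDl ?mulr_gt0 ?ltr0Sn //.
  by rewrite !mulr_ge0.
- rewrite /q -subr_ge0.
  have [d Dd] : exists d, n.+1 = (j.+2 + d)%N by exists (n.+1 - j.+2)%N; rewrite subnKC.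
  have -> : (n.+1 - j.+2)%N = d by rewrite Dd addKn.
  have -> : (n.+1 - j.+1)%N = d.+1 by rewrite Dd addSnnS addKn.
  have -> : (n.+1 - j)%N = d.+2 by rewrite Dd !addSnnS addKn.
  have h1 : 0 <= d%:R * (p j.+1 ^+ 2 - p j * p j.+2).
    case: d Dd => [|d] Dd; first by rewrite mul0r.
    by rewrite mulr_ge0 // subr_ge0 newt // -ltnS Dd !addSnnS !addnS leq_addr.
  have h2 : 0 <= j%:R * (p j ^+ 2 - p j.-1 * p j.+1).
    case: j jn {Dd h1} => [|j] jn; first by rewrite mul0r.
    by rewrite mulr_ge0 // subr_ge0 newt.
  (* Two consecutive Newton inequalities are multiplied and [p j * p j.+1] is cancelled; this
     product is positive when [p j.-1] is, and otherwise the claim is trivial. *)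
  have h3 : 0 <= j%:R * d%:R * (p j * p j.+1 - p j.-1 * p j.+2).
    case: j jn Dd {h1 h2} => [|j] jn Dd; first by rewrite !mul0r.
    case: d Dd => [|d] Dd; first by rewrite mulr0 mul0r.
    have jn2 : (j.+3 <= n)%N by rewrite -ltnS Dd !addSnnS !addnS leq_addr.
    rewrite mulr_ge0 ?mulr_ge0 // subr_ge0 /=.
    have [->|pj] := eqVneq (p j) 0; first by rewrite mul0r mulr_ge0.
    have {}pj : 0 < p j by rewrite lt_neqAle eq_sym pj p0.
    have pj1 : 0 < p j.+1 by rewrite posp // ltnW // ltnW.
    have pj2 : 0 < p j.+2 by rewrite posp // ltnW.
    rewrite -(ler_pM2r (mulr_gt0 pj1 pj2)).
    rewrite [leLHS](_ : _ = (p j * p j.+2) * (p j.+1 * p j.+3)); last by ring.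
    rewrite [leRHS](_ : _ = p j.+1 ^+ 2 * p j.+2 ^+ 2); last by ring.
    by apply: ler_pM; rewrite ?mulr_ge0 // newt // ltnW.
  have h4 : 0 <= (p j - x * p j.+1) ^+ 2.
    by rewrite real_exprn_even_ge0 // rpredB ?rpredM ?ger0_real.
  have n2 : 0 < n.+1%:R ^+ 2 :> F by rewrite exprn_gt0 ?ltr0Sn.
  rewrite -(pmulr_lge0 _ n2) /=.
  (* Cleared of denominators, the Newton difference of [q] is a square plus nonnegative multiples of
     the differences in [h1], [h2] and [h3]. *)
  rewrite [X in 0 <= X](_ : _ = (p j - x * p j.+1) ^+ 2
    + j.+2%:R * (j%:R * (p j ^+ 2 - p j.-1 * p j.+1))
    + x ^+ 2 * d.+2%:R * (d%:R * (p j.+1 ^+ 2 - p j * p j.+2))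
    + x * (j%:R * d%:R * (p j * p j.+1 - p j.-1 * p j.+2))).
    apply: addr_ge0; last exact: mulr_ge0 x0 h3.
    apply: addr_ge0; last by apply: mulr_ge0 h1; rewrite mulr_ge0 ?exprn_ge0.
    by apply: addr_ge0 => //; apply: mulr_ge0.
  by field; rewrite nat1r.
Qed.

Section NewtonMatchings.
Variables (TA TB : finType) (E : TA -> TB -> bool).
Local Notation n := #|TA|.

(** The coefficients are reversed so that the polynomial is monic, by [m_0 = 1], and evaluates to
    [mpart] at constant weights. *)
Definition matching_poly (R : comNzRingType) : {poly R} :=
  \poly_(j < n.+1) (num_matchings E (n - j))%:R.

Lemma horner_matching_poly (R : comNzRingType) (x : R) :
  (matching_poly R).[x] = mpart E (fun=> x) (enum TB) setT.
Proof.
rewrite horner_poly mpart_num_matchings (reindex_inj rev_ord_inj) /=.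
by apply: eq_bigr => k _; rewrite subSS subKn // -ltnS.
Qed.

Lemma num_matchings0 : num_matchings E 0 = 1%N.
Proof.
rewrite /num_matchings (_ : [set _ | _] = [set set0]) ?cards1 //.
apply/setP => M; rewrite !inE cards_eq0 andbC; case: eqVneq => //= ->.
by apply/is_matchingP; split=> i u; rewrite ?inE // => j v; rewrite inE.
Qed.

(** Stability, applied to a root and to its conjugate, makes every root real; positivity of [mpart]
    at positive weights excludes positive roots. *)
Lemma matching_poly_factors : exists r : seq algC,
  [/\ size r = n, {in r, forall x, 0 <= x} &
      matching_poly algC = \prod_(x <- r) ('X + x%:P)].
Proof.
set P := matching_poly algC.
have lcP : (num_matchings E (n - n))%:R != 0 :> algC by rewrite subnn num_matchings0 oner_eq0.
have sP : size P = n.+1 by rewrite size_poly_eq.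
have [s Ps] := closed_field_poly_normal P.
rewrite lead_coef_poly // subnn num_matchings0 scale1r in Ps.
have ss : size s = n.
  by apply/eqP; rewrite -eqSS -sP Ps size_prod_XsubC.
exists (map -%R s); split; rewrite ?size_map //.
  move=> _ /mapP[x xs ->].
  have Px : P.[x] = 0 by apply/rootP; rewrite Ps root_prod_XsubC.
  have uTB : uniq (enum TB) by rewrite enum_uniq.
  have notpos y : P.[y] = 0 -> ~~ (0 < 'Im y).
    by move=> Py; apply/negP => /(mpart_stable E setT uTB); rewrite -horner_matching_poly -/P Py eqxx.
  have Pxc : P.[x^*] = 0.
    rewrite -[RHS](rmorph0 (@Num.conj algC)) -Px -horner_map /=; congr (_.[_]).
    by apply/polyP => j; rewrite coef_map /= !coef_poly; case: ifP; rewrite ?rmorph_nat ?rmorph0.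
  have Rx : x \is Num.real.
    apply/Creal_ImP/eqP; have := notpos _ Px; have := notpos _ Pxc.
    rewrite Im_conj oppr_gt0 -!real_leNgt ?Creal_Im ?real0 // => x0 x0'.
    by rewrite eq_le x0' x0.
  rewrite oppr_ge0 real_leNgt ?real0 //; apply/negP => x0.
  by have := mpart_gt0 E (enum TB) setT (fun=> x0); rewrite -horner_matching_poly -/P Px ltxx.
rewrite Ps big_map; apply: eq_bigr => x _; by rewrite polyCN.
Qed.
End NewtonMatchings.

(** The factorization lives in [algC], but with the binomials cleared the inequalities compare
    natural numbers, so they transfer to any [R]. *)
Lemma num_matchings_Newton (TA TB : finType) (E : TA -> TB -> bool)
    (R : realFieldType) (n := #|TA|) : exists p : nat -> R,
  [/\ forall j, 0 <= p j,
    forall j, (j <= n)%N -> (num_matchings E (n - j))%:R = 'C(n, j)%:R * p j,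
    forall j, (j < n)%N -> 0 < p j -> 0 < p j.+1 &
    forall j, (j.+2 <= n)%N -> p j * p j.+2 <= p j.+1 ^+ 2].
Proof.
have [r [sr r0 Pr]] := matching_poly_factors E.
have [p [p0 coefp posp newt]] := Newton_prod_XaddC r0.
rewrite -Pr sr -/n in coefp posp newt.
have bin0 j (F : numDomainType) : (j <= n)%N -> 0 < 'C(n, j)%:R :> F by rewrite ltr0n bin_gt0.
have cross (F : numFieldType) (a b c d : F) : 0 < b -> 0 < d ->
    (a / b <= c / d) = (a * d <= c * b).
  by move=> b0 d0; rewrite ler_pdivrMr // mulrAC ler_pdivlMr.
have pE j : (j <= n)%N -> p j = (num_matchings E (n - j))%:R / 'C(n, j)%:R.
  move=> jn; have := coefp j; rewrite coef_poly ltnS jn => ->.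
  by rewrite mulrC mulKf // gt_eqF ?bin0.
exists (fun j => (num_matchings E (n - j))%:R / 'C(n, j)%:R); split=> [j|j jn|j jn|j jn].
- exact: divr_ge0.
- by rewrite mulrC divfK // gt_eqF ?bin0.
- have := posp j jn; rewrite !pE ?(ltnW jn) // !pmulr_lgt0 ?invr_gt0 ?bin0 ?(ltnW jn) //.
  by rewrite !ltr0n.
- have := newt j jn; have j1n := ltnW jn; have j0n := ltnW j1n; rewrite !pE //.
  rewrite !mulf_div !expr_div_n !cross ?mulr_gt0 ?exprn_gt0 ?bin0 //.
  by rewrite -!natrX -!natrM !ler_nat.
Qed.

(** * From lower bounds at all [z > 0] to a bound on one coefficient *)

Lemma poly_ge_coef (R : realFieldType) (a : nat -> R) n l D :
  (forall j, 0 <= a j) -> (l <= n)%N -> (forall j, (j < l)%N -> a j = 0) ->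
  (forall z, 0 < z -> D * z ^+ l <= \sum_(j < n.+1) a j * z ^+ j) -> D <= a l.
Proof.
move=> a0 ln al H; apply/ler_addgt0Pr => e e0.
pose s := \sum_(j < n.+1) a j.
have s0 : 0 <= s by rewrite sumr_ge0.
(* A small [z] isolates the coefficient [a l]: all higher terms together are at most
   [s * z * z ^+ l], and [s * z <= e]. *)
pose z := Num.min 1 (e / (s + 1)).
have z0 : 0 < z by rewrite lt_min ltr01 divr_gt0 // ltr_wpDl.
have z1 : z <= 1 by rewrite ge_min lexx.
rewrite -(ler_pM2r (exprn_gt0 l z0)); apply: le_trans (H z z0) _.
have ln' : (l < n.+1)%N by [].
rewrite (bigD1 (Ordinal ln')) //= mulrDl lerD2l.
apply: (@le_trans _ _ (s * (z * z ^+ l))); last first.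
  rewrite mulrA ler_wpM2r ?exprn_ge0 ?ltW //.
  have : z * (s + 1) <= e by rewrite -ler_pdivlMr ?ltr_wpDl // ge_min lexx orbT.
  nra.
rewrite -exprS mulr_suml [leRHS](bigD1 (Ordinal ln')) //=.
apply: ler_wpDl; first by rewrite mulr_ge0 ?exprn_ge0 ?(ltW z0).
apply: ler_sum => j jl; have [jl'|lj] := ltnP j l; first by rewrite al // !mul0r.
rewrite ler_wpM2l // ler_wiXn2l ?(ltW z0) //.
by rewrite ltn_neqAle lj andbT eq_sym; apply: contraNneq jl => e'; apply/eqP/val_inj.
Qed.

(* Log-concavity of [p] bounds it by the geometric sequence through [p l] and
   [p l.+1], so the polynomial is at most a multiple of [(1 + s z) ^+ n]; the
   value [z = l / ((n - l) s)] is the optimal one. *)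
Lemma coef_ge_binomial (R : realFieldType) (p : nat -> R) n l D :
  (l < n)%N -> 0 <= D -> (forall j, 0 <= p j) ->
  (forall j, (j < n)%N -> 0 < p j -> 0 < p j.+1) ->
  (forall j, (j.+2 <= n)%N -> p j * p j.+2 <= p j.+1 ^+ 2) ->
  (forall z, 0 < z -> D * z ^+ l <= \sum_(j < n.+1) 'C(n, j)%:R * p j * z ^+ j) ->
  D * (l%:R / n%:R) ^+ l * ((n - l)%:R / n%:R) ^+ (n - l) <= p l.
Proof.
move=> ln D0 p0 posp newt H.
have n0 : 0 < n%:R :> R by rewrite ltr0n (leq_ltn_trans _ ln).
have d0 : 0 < (n - l)%:R :> R by rewrite ltr0n subn_gt0.
have [pl|pl] := eqVneq (p l) 0.
  (* Zeros propagate downwards, so letting [z] tend to 0 forces [D = 0]. *)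
  have pj j : (j <= l)%N -> p j = 0.
    move=> jl; have [i] := ubnP (l - j); elim: i j jl => // i IH j jl ij.
    have [->//|jl'] := eqVneq j l.
    have {}jl : (j < l)%N by rewrite ltn_neqAle jl' jl.
    apply: contraTeq (lexx 0 : (0 : R) <= 0) => pj; have := posp j (ltn_trans jl ln).
    rewrite lt_neqAle eq_sym pj p0 => /(_ isT).
    by rewrite IH ?ltxx // subnS -ltnS prednK // subn_gt0.
  have : D <= 'C(n, l)%:R * p l.
    apply: (@poly_ge_coef _ (fun j => 'C(n, j)%:R * p j) n) => //.
    - by move=> j; rewrite mulr_ge0.
    - exact: ltnW.
    - by move=> j /ltnW/pj ->; rewrite mulr0.
  by rewrite pl mulr0 => D0'; rewrite (le_anti (introT andP (conj D0' D0))) !mul0r.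
(* The optimal [z] would be 0 when [l = 0]; there the limit at 0 is used instead. *)
have [l0|l0] := posnP l.
  rewrite l0 in H *; rewrite subn0 divff ?gt_eqF // expr1n expr0 !mulr1.
  have := @poly_ge_coef _ (fun j => 'C(n, j)%:R * p j) n 0 D _ _ _ H.
  by rewrite bin0 mul1r; apply=> // j; rewrite mulr_ge0.
have {}pl : 0 < p l by rewrite lt_neqAle eq_sym pl p0.
have pl1 : 0 < p l.+1 by apply: posp.
pose s := p l.+1 / p l; have s0 : 0 < s by rewrite divr_gt0.
have up j : (l + j <= n)%N -> 0 < p (l + j)%N.
  elim: j => [|j IH]; rewrite ?addn0 // addnS => jn.
  by apply: posp => //; apply: IH; apply: ltnW.
have ups j : (l + j < n)%N -> p (l + j).+1 <= s * p (l + j)%N.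
  elim: j => [|j IH]; rewrite ?addn0 /s ?divfK ?gt_eqF // addnS => jn.
  have pj := up j (ltnW (ltnW jn)); rewrite -(ler_pM2l pj).
  apply: le_trans (newt _ jn) _; rewrite expr2 mulrA ler_wpM2r // mulrC.
  exact: IH (ltnW jn).
have dns j : (j <= l)%N -> s * p (l - j)%N <= p (l - j).+1.
  elim: j => [|j IH] jl; first by rewrite subn0 /s divfK ?gt_eqF.
  have := IH (ltnW jl); rewrite -(subSS j l) subSn //.
  set i := (l - j.+1)%N => Hi; have [->|pi] := eqVneq (p i) 0; first by rewrite mulr0.
  have {}pi : 0 < p i by rewrite lt_neqAle eq_sym pi p0.
  have i2 : (i.+2 <= n)%N by rewrite /i -subSn // subSS -subSn ?(ltnW jl) // leq_subLR (leq_trans ln) ?leq_addl.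
  have pi1 : 0 < p i.+1 by apply: posp => //; apply: ltnW.
  rewrite -(ler_pM2r pi1) -expr2; apply: le_trans _ (newt _ i2).
  by rewrite -mulrA mulrCA ler_wpM2l.
(* This is [p j <= p l * s ^ (j - l)], stated without negative exponents: consecutive ratios are at
   most [s] above [l] and at least [s] below. *)
have geom j : (j <= n)%N -> p j * s ^+ l <= p l * s ^+ j.
  have [jl|lj] := leqP j l => jn.
    rewrite -(subKn jl); elim: (l - j)%N (leq_subr j l) => [|i IH] il; first by rewrite subn0.
    have := dns _ il; rewrite -subSn // subSS => h.
    rewrite -(ler_pM2l s0) mulrA; apply: (@le_trans _ _ (p (l - i)%N * s ^+ l)).
      by rewrite ler_wpM2r ?exprn_ge0 ?(ltW s0).
    by rewrite mulrCA -exprS -subSn // subSS; exact: IH (ltnW il).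
  rewrite -(subnKC (ltnW lj)) in jn *; elim: (j - l)%N jn => [|i IH]; first by rewrite addn0.
  rewrite addnS => jn; rewrite exprS mulrCA.
  apply: (@le_trans _ _ (s * (p (l + i)%N * s ^+ l))); last by rewrite ler_wpM2l ?(ltW s0) // IH // ltnW.
  by rewrite mulrA ler_wpM2r ?exprn_ge0 ?(ltW s0) // ups.
pose z := l%:R / ((n - l)%:R * s).
have l0' : 0 < l%:R :> R by rewrite ltr0n.
have z0 : 0 < z by rewrite /z divr_gt0 // mulr_gt0.
have key : D * z ^+ l * s ^+ l <= p l * (n%:R / (n - l)%:R) ^+ n.
  apply: (@le_trans _ _ ((\sum_(j < n.+1) 'C(n, j)%:R * p j * z ^+ j) * s ^+ l)).
    by rewrite ler_wpM2r ?exprn_ge0 ?(ltW s0) ?H.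
  have -> : n%:R / (n - l)%:R = s * z + 1 :> R.
    by rewrite /z natrB ?(ltnW ln) //; field; rewrite -natrB ?(ltnW ln) // !gt_eqF.
  rewrite addrC exprDn mulr_suml mulr_sumr ler_sum // => j _.
  rewrite expr1n mul1r -[in leRHS]mulr_natl [in leRHS]exprMn.
  rewrite [leLHS](_ : _ = 'C(n, j)%:R * z ^+ j * (p j * s ^+ l)); last by ring.
  rewrite [leRHS](_ : _ = 'C(n, j)%:R * z ^+ j * (p l * s ^+ j)); last by ring.
  by rewrite ler_wpM2l ?mulr_ge0 ?exprn_ge0 ?(ltW z0) // geom // -ltnS.
have nl0 : 0 < (n%:R / (n - l)%:R) ^+ n :> R by rewrite exprn_gt0 ?divr_gt0.
rewrite -(ler_pM2r nl0); apply: le_trans key.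
rewrite le_eqVlt; apply/orP; left; apply/eqP.
have -> : (n%:R / (n - l)%:R) ^+ n = (n%:R / (n - l)%:R) ^+ l * (n%:R / (n - l)%:R) ^+ (n - l) :> R.
  by rewrite -exprD subnKC // ltnW.
rewrite -[RHS]mulrA -exprMn.
have -> : z * s = l%:R / (n - l)%:R by rewrite /z; field; rewrite !gt_eqF.
rewrite mulrACA -mulrA -exprMn [X in _ * (_ * X)](_ : _ = 1).
  by rewrite mulr1 -mulrA -exprMn; congr (_ * _ ^+ _); field; rewrite !gt_eqF.
by rewrite [X in X ^+ _](_ : _ = 1) ?expr1n //; field; rewrite !gt_eqF.
Qed.

(** * The capacity bound *)

Section Analysis.
(* [exp], [ln], ... would otherwise parse their arguments in [R_scope]. *)
Local Arguments exp _%_ring_scope.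
Local Arguments ln _%_ring_scope.
Local Arguments Hent _%_ring_scope.
Local Arguments Gab _ _ _%_ring_scope.

Lemma exp_gt0 (x : R) : 0 < exp x.
Proof. by apply/RltP; exact: exp_pos. Qed.

Lemma exp_lnK (x : R) : 0 < x -> exp (ln x) = x.
Proof. by move=> x0; apply: exp_ln; apply/RltP. Qed.

Lemma expD (x y : R) : exp (x + y) = exp x * exp y.
Proof. exact: exp_plus. Qed.

Lemma expB (x y : R) : exp (x - y) = exp x / exp y.
Proof. by rewrite expD; congr (_ * _); exact: exp_Ropp. Qed.

Lemma exp_tangent (x y : R) : exp y * (1 + (x - y)) <= exp x.
Proof.
have -> : exp x = exp y * exp (x - y) by rewrite -expD subrKC.
rewrite ler_wpM2l ?(ltW (exp_gt0 y)) //.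
by apply/RleP; exact: exp_ineq1_le.
Qed.

Lemma exp_sum (I : Type) (r : seq I) (P : pred I) (F : I -> R) :
  exp (\sum_(i <- r | P i) F i) = \prod_(i <- r | P i) exp (F i).
Proof. by apply: (big_morph exp) => [x y|]; rewrite ?expD ?expR0. Qed.

(** Jensen's inequality: in the sum of the tangents at the mean the linear terms cancel. *)
Lemma exp_mean (I : finType) (A : {set I}) (F : I -> R) : (0 < #|A|)%N ->
  #|A|%:R * exp ((\sum_(i in A) F i) / #|A|%:R) <= \sum_(i in A) exp (F i).
Proof.
move=> A0; set m := _ / _.
apply: (@le_trans _ _ (\sum_(i in A) exp m * (1 + (F i - m)))); last first.
  by apply: ler_sum => i _; exact: exp_tangent.
rewrite -mulr_sumr big_split /= sumrB !sumr_const -[m *+ _]mulr_natl /m.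
by rewrite mulrCA divff ?pnatr_eq0 -?lt0n // mulr1 subrr addr0 mulrC.
Qed.

(* Weighted AM-GM; at [w = 0] and [w = 1] the junk value of [ln 0] is
   multiplied by 0. *)
Lemma exp_entropy_le (w x y : R) : 0 <= w -> w <= 1 -> 0 < x -> 0 < y ->
  exp (w * (ln x - ln w) + (1 - w) * (ln y - ln (1 - w))) <= x + y.
Proof.
move=> w0 w1 x0 y0.
have [->|wn0] := eqVneq w 0.
  by rewrite subr0 mul0r add0r mul1r expB !exp_lnK // divr1 lerDr ltW.
have [->|wn1] := eqVneq w 1.
  by rewrite subrr mul0r addr0 mul1r expB !exp_lnK // divr1 lerDl ltW.
have {wn0} w0 : 0 < w by rewrite lt_neqAle eq_sym wn0 w0.
have {wn1} w1 : 0 < 1 - w by rewrite subr_gt0 lt_neqAle wn1 w1.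
set s := ln x - _; set t := ln y - _; set m := _ + _.
have -> : x = w * exp s by rewrite expB !exp_lnK // mulrC divfK ?gt_eqF.
have -> : y = (1 - w) * exp t by rewrite expB !exp_lnK // mulrC divfK ?gt_eqF.
have h1 := exp_tangent s m; have h2 := exp_tangent t m.
apply: (@le_trans _ _ (w * (exp m * (1 + (s - m))) + (1 - w) * (exp m * (1 + (t - m))))).
  by rewrite le_eqVlt; apply/orP; left; apply/eqP; rewrite /m; ring.
by rewrite lerD // ler_wpM2l // ltW.
Qed.

(** With the best [t] in the hypothesis, what remains is AM-GM for [s] and [1] with weights [l] and
    [1 - l]. *)
Lemma capacity_step (b : nat) (l f s d : R) : (0 < b)%N -> 0 < l -> l <= 1 ->
  0 < f -> 0 <= s ->
  (forall t, exp (d + l * t) <= f * (1 + exp t * s / b%:R) ^+ b) ->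
  exp (d + ((b%:R - l) * (ln (b%:R - l) - ln b%:R) - (1 - l) * ln (1 - l)))
    <= f * (1 + s).
Proof.
move=> b0 l0 l1 f0 s0 H.
(* For [b = 1] the constant vanishes and [t = 0] suffices; for larger [b], [b - l] is positive even
   at [l = 1]. *)
case: b b0 H => [//|[|b]] _ H.
  rewrite ln_1 subr0 subrr addr0; have := H 0.
  by rewrite mulr0 addr0 expR0 mul1r divr1 expr1.
set B : R := b.+2%:R in H *.
have B1 : 1 < B by rewrite ltr1n.
have Bl : 0 < B - l by lra.
have B0 : 0 < B by lra.
have [{s0}s0|sn0] := boolP (0 < s); last first.
  have {sn0 s0} s0 : s = 0 by apply/eqP; rewrite eq_le leNgt sn0 s0.
  rewrite s0 in H.
  (* If [s = 0], the left side would stay below [f] for all [t]; this [t] makes it [2 * f]. *)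
  have := H ((ln (2 * f) - d) / l); rewrite [l * _]mulrC divfK ?gt_eqF // subrKC.
  by rewrite exp_lnK ?mulr_gt0 // mulr0 mul0r addr0 expr1n mulr1; lra.
set L := ln (B - l); set Lb := ln B; set Ll := ln l.
(* The minimiser of [(1 + exp t * s / B) ^+ b.+2 * exp (- l * t)]. *)
pose t := Ll + Lb - L - ln s.
have := H t.
have -> : 1 + exp t * s / B = exp (Lb - L).
  rewrite /t !expB expD !exp_lnK //; field.
  by rewrite (_ : 2 + b%:R = B) ?gt_eqF // /B -natrD.
rewrite expRX => Ht.
have -> : d + ((B - l) * (L - Lb) - (1 - l) * ln (1 - l)) =
   (d + l * t) + (l * (ln s - Ll) + (1 - l) * (ln 1 - ln (1 - l)) - (Lb - L) *+ b.+2).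
  by rewrite -[_ *+ b.+2]mulr_natr -/B /t (ln_1 : ln 1 = 0); ring.
rewrite expD expB mulrA ler_pdivrMr ?exp_gt0 // [leRHS]mulrAC.
apply: ler_pM; rewrite ?(ltW (exp_gt0 _)) //.
by rewrite [leRHS]addrC; apply: exp_entropy_le => //; apply: ltW.
Qed.

Section Biregular.
Variables (a b : nat) (TA TB : finType) (E : TA -> TB -> bool).
Hypotheses (a0 : (0 < a)%N) (b0 : (0 < b)%N).
Hypothesis degA : forall x : TA, #|[set y : TB | E x y]| = a.
Hypothesis degB : forall y : TB, #|[set x : TA | E x y]| = b.
Variables (q z l : R).
Hypotheses (q0 : 0 < q) (q1 : q <= 1) (z0 : 0 < z).
Hypotheses (l0 : 0 < l) (l1 : l <= 1) (lE : l = q * b%:R / a%:R).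

(** [g] is the logarithm of [C(l)]. Below, [exp c] is the AM-GM lower bound for [z + a] with weights
    [1 - q] and [q]. *)
Let g := (b%:R - l) * (ln (b%:R - l) - ln b%:R) - (1 - l) * ln (1 - l).
Let c := (1 - q) * (ln z - ln (1 - q)) + q * (ln a%:R - ln q).

(** The vertices of [W] still enter as positive variables [x_u = exp (xi u)]. *)
Let weight (W : seq TB) (xi : TB -> R) (i : TA) : R :=
  z + \sum_(u <- W | E i u) exp (xi u).

(** For each [i], Jensen over its [a] neighbours and then AM-GM with weights [q] and [1 - q]. Each
    [xi u] collects [q / a] from [b] vertices, which is [l]. *)
Lemma capacity_base (xi : TB -> R) :
  exp (#|TA|%:R * c + l * \sum_(u <- enum TB) xi u) <= mpart E (weight (enum TB) xi) [::] setT.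
Proof.
have -> : #|TA|%:R * c + l * \sum_(u <- enum TB) xi u =
    \sum_(i in [set: TA]) (c + q / a%:R * \sum_(u | E i u) xi u).
  rewrite big_split /= sumr_const cardsT; congr (_ + _); first by rewrite mulr_natl.
  rewrite -mulr_sumr (exchange_big_dep xpredT) //= big_enum /= lE.
  rewrite [in RHS](eq_bigr (fun u => b%:R * xi u)) => [|u _].
    have -> : \sum_(u in TB) xi u = \sum_u xi u by apply: eq_bigl.
    by rewrite -mulr_sumr; ring.
  rewrite sumr_const -(degB u) mulr_natl; congr (_ *+ _).
  by apply: eq_card => i; rewrite inE unfold_in inE.
rewrite exp_sum /=; apply: ler_prod => i _; rewrite ltW ?exp_gt0 //=.
rewrite /weight big_enum_cond /=.
have := @exp_mean _ [set u | E i u] xi; rewrite degA => /(_ a0).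
set m := (_ / _) => hm.
have S1 : \sum_(u in [set u | E i u]) exp (xi u) = \sum_(u | E i u) exp (xi u).
  by apply: eq_bigl => u; rewrite inE.
have S2 : \sum_(u in [set u | E i u]) xi u = \sum_(u | E i u) xi u.
  by apply: eq_bigl => u; rewrite inE.
rewrite S1 in hm; apply: (@le_trans _ _ (z + a%:R * exp m)); last by rewrite lerD2l.
have am0 : 0 < a%:R * exp m by rewrite mulr_gt0 ?ltr0n ?exp_gt0.
have ln_am : ln (a%:R * exp m) = ln a%:R + m.
  by rewrite (ln_mult _ _ (elimT RltP _) (exp_pos _)) ?ltr0n // ln_exp.
rewrite [leRHS]addrC; apply: le_trans (exp_entropy_le (ltW q0) q1 am0 z0).
rewrite ln_am le_eqVlt; apply/orP; left; apply/eqP; congr exp.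
by rewrite /c /m S2; ring.
Qed.

(** To move [u] into [U], the induction hypothesis is used with [u] as a variable [exp t], for every
    [t]. [mpart_shift_le] and AM-GM over the [b] neighbours of [u] give the upper bound that
    [capacity_step] needs. *)
Lemma mpart_capacity U W (xi : TB -> R) : perm_eq (U ++ W) (enum TB) ->
  exp (#|TA|%:R * c + (size U)%:R * g + l * \sum_(u <- W) xi u)
    <= mpart E (weight W xi) U setT.
Proof.
elim: U W xi => [|u U IH] W xi /= perm.
  rewrite mul0r addr0 (perm_big _ perm) /=; apply: le_trans (capacity_base xi) _.
  rewrite le_eqVlt; apply/orP; left; apply/eqP; apply: eq_mpart => i.
  by rewrite /weight (perm_big _ perm).
have /= /andP[uUW uqUW] : uniq (u :: U ++ W) by rewrite (perm_uniq perm) enum_uniq.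
have uqU : uniq U by move: uqUW; rewrite cat_uniq => /andP[].
have uW : u \notin W by move: uUW; rewrite mem_cat negb_or => /andP[].
set w := weight W xi.
have w0 i : 0 < w i by rewrite ltr_pwDl ?sumr_ge0 // => v _; rewrite ltW ?exp_gt0.
set f := mpart E w U setT; have f0 : 0 < f by exact: mpart_gt0.
(* With this [s], the value of [mpart] on [u :: U] is [f * (1 + s)]. *)
pose s := \sum_(i | E i u) mpart E w U (setT :\ i) / f.
have s0 : 0 <= s.
  by rewrite sumr_ge0 // => i _; rewrite divr_ge0 ?(ltW f0) // ltW ?mpart_gt0.
have -> : \sum_(i in [set: TA] | E i u) mpart E w U (setT :\ i) = f * s.
  rewrite mulr_sumr; apply: eq_big => [i|i _]; first by rewrite inE.
  by rewrite mulrC divfK ?gt_eqF.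
rewrite -[f + _](_ : f * (1 + s) = _); last by rewrite mulrDr mulr1.
set d := #|TA|%:R * c + (size U)%:R * g + l * \sum_(v <- W) xi v.
rewrite [X in exp X](_ : _ = d + g); last by rewrite /d -natr1; ring.
apply: capacity_step => // t.
pose xi' v := if v == u then t else xi v.
have xiW v : v \in W -> xi' v = xi v by rewrite /xi'; case: eqVneq => // ->; rewrite (negbTE uW).
have perm' : perm_eq (U ++ u :: W) (enum TB) by rewrite perm_catC /= (perm_trans _ perm) //= perm_cons perm_catC.
have := IH (u :: W) xi' perm'.
rewrite big_cons {1}/xi' eqxx.
rewrite (eq_big_seq xi) //.
rewrite [X in exp X](_ : _ = d + l * t); last by rewrite /d; ring.
move=> /le_trans; apply.
set N := enum [set i | E i u].
rewrite (@eq_mpart _ _ _ _ _ (fun i => w i + (if i \in N then exp t else 0))); last first.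
  move=> i; rewrite /weight mem_enum inE /w /weight big_cons {1}/xi' eqxx.
  rewrite big_seq_cond (eq_bigr (fun v => exp (xi v))) => [|v /andP[/xiW-> _] //].
  rewrite -big_seq_cond.
  by case: ifP => _; rewrite ?addr0 // -addrA; congr (_ + _); rewrite addrC.
have uqN : uniq N by rewrite enum_uniq.
have NT : {subset N <= [set: TA]} by move=> i; rewrite inE.
apply: le_trans (mpart_shift_le E uqU w0 (ltW (exp_gt0 t)) NT uqN) _.
rewrite -/f ler_wpM2l ?(ltW f0) // /N big_enum /=.
have := leif_AGM (A := [set i | E i u]) (E := fun i => 1 + exp t * (mpart E w U (setT :\ i) / f)).
rewrite /= degB => AGM.
apply: le_trans (AGM _) _.
  by move=> i _; rewrite addr_ge0 // mulr_ge0 ?(ltW (exp_gt0 _)) // divr_ge0 ?(ltW f0) // ltW // mpart_gt0.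
rewrite le_eqVlt; apply/orP; left; apply/eqP; congr (_ ^+ _).
rewrite big_split /= sumr_const degB -mulr_sumr mulrDl divff ?pnatr_eq0 -?lt0n //.
by congr (_ + _ * _ / _); apply: eq_bigl => i; rewrite inE.
Qed.
End Biregular.

(** * The entropy form of the bound *)

Lemma lnM (x y : R) : 0 < x -> 0 < y -> ln (x * y) = ln x + ln y.
Proof. by move=> x0 y0; exact: (ln_mult _ _ (elimT RltP x0) (elimT RltP y0)). Qed.

Lemma lnV (x : R) : 0 < x -> ln x^-1 = - ln x.
Proof. by move=> x0; exact: (ln_Rinv _ (elimT RltP x0)). Qed.

(** The formula persists at [x = 1], where [ln 0] has coefficient 0. *)
Lemma HentE (x : R) : 0 < x -> Hent x = - (x * ln x + (1 - x) * ln (1 - x)).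
Proof.
move=> x0; rewrite /Hent; case: (RIneq.Req_dec_T x (IZR 0)) => [xE|nx0] /=.
  by move: x0; rewrite xE ltxx.
case: (RIneq.Req_dec_T x (IZR 1)) => [xE|nx1] //=.
by rewrite xE (ln_1 : ln 1 = 0) subrr !(mulr0, mul0r) addr0 oppr0.
Qed.

Lemma mean_parameter (F : realFieldType) (a b n m k : nat) : (0 < a)%N -> (0 < b)%N ->
  (n * a = m * b)%N -> (0 < n)%N ->
  (a%:R + b%:R) / (2 * b%:R) * (2 * k%:R / (n%:R + m%:R)) = k%:R / n%:R :> F.
Proof.
move=> a0 b0 nam n0.
have A0 : 0 < a%:R :> F by rewrite ltr0n.
have B0 : 0 < b%:R :> F by rewrite ltr0n.
have N0 : 0 < n%:R :> F by rewrite ltr0n.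
have MB : m%:R = n%:R * a%:R / b%:R :> F by rewrite -natrM nam natrM mulfK ?gt_eqF.
have -> : n%:R + m%:R = n%:R * (a%:R + b%:R) / b%:R :> F.
  by rewrite MB; field; rewrite gt_eqF.
by field; rewrite !gt_eqF ?addr_gt0.
Qed.

(** The three entropies are taken at [l], [q] and [l / b]; once the logarithms of quotients are
    split, the identity is algebraic. *)
Lemma Gab_exponent (a b n m k : nat) : (0 < a)%N -> (0 < b)%N -> (n * a = m * b)%N ->
  (0 < k)%N -> (k <= n)%N -> (k <= m)%N ->
  let q : R := k%:R / n%:R in let l : R := k%:R / m%:R in
  INR (n + m) * Gab a b (2 * INR k / INR (n + m)) =
  m%:R * ((b%:R - l) * (ln (b%:R - l) - ln b%:R) - (1 - l) * ln (1 - l))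
  + k%:R * (ln a%:R - ln q) - (n - k)%:R * ln (1 - q).
Proof.
move=> a0 b0 nam k0 kn km q l; rewrite /Gab !INRE.
rewrite -!(RmultE, RplusE, RdivE, RinvE, RminusE) !(RmultE, RplusE, RdivE, RinvE, RminusE).
rewrite (_ : IZR 2 = 2 :> R) // natrD natrB //.
have A0 : 0 < a%:R :> R by rewrite ltr0n.
have B0 : 0 < b%:R :> R by rewrite ltr0n.
have K0 : 0 < k%:R :> R by rewrite ltr0n.
have M0 : 0 < m%:R :> R by rewrite ltr0n (leq_trans k0).
have N0 : 0 < n%:R :> R by rewrite ltr0n (leq_trans k0).
have NA : n%:R = m%:R * b%:R / a%:R :> R.
  by rewrite -natrM -nam natrM mulfK ?gt_eqF.
have lnN : ln n%:R = ln m%:R + ln b%:R - ln a%:R.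
  by rewrite NA !lnM ?lnV ?invr_gt0 ?mulr_gt0.
have l0 : 0 < l by rewrite divr_gt0.
have q0 : 0 < q by rewrite divr_gt0.
have l1 : l <= 1 by rewrite ler_pdivrMr // mul1r ler_nat.
have lb : l <= b%:R by rewrite (le_trans l1) // ler1n.
have lnl : ln l = ln k%:R - ln m%:R by rewrite lnM ?invr_gt0 // lnV.
have lnq : ln q = ln k%:R - ln n%:R by rewrite lnM ?invr_gt0 // lnV.
have lnlb : ln (l / b%:R) = ln l - ln b%:R by rewrite lnM ?invr_gt0 // lnV.
have AB0 : 0 < a%:R + b%:R :> R by rewrite addr_gt0.
have nz := (gt_eqF A0, gt_eqF B0, gt_eqF K0, gt_eqF M0, gt_eqF AB0).
have nm : n%:R + m%:R = m%:R * (a%:R + b%:R) / a%:R :> R.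
  by rewrite NA; field; rewrite !nz.
have -> : (a%:R + b%:R) / (2 * a%:R) * (2 * k%:R / (n%:R + m%:R)) = l.
  by rewrite nm /l; field; rewrite !nz.
rewrite (mean_parameter R k a0 b0 nam (leq_trans k0 kn)) -/q.
have -> : (a%:R + b%:R) / (2 * a%:R * b%:R) * (2 * k%:R / (n%:R + m%:R)) = l / b%:R.
  by rewrite nm /l; field; rewrite !nz.
have lnlb1 : (1 - l / b%:R) * ln (1 - l / b%:R) =
    (1 - l / b%:R) * (ln (b%:R - l) - ln b%:R).
  have -> : 1 - l / b%:R = (b%:R - l) / b%:R by field; rewrite !nz.
  have [bl|bl] := eqVneq (b%:R - l) 0; first by rewrite bl !mul0r.
  by rewrite lnM ?invr_gt0 // ?lnV // lt_neqAle eq_sym bl subr_ge0.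
rewrite !HentE ?divr_gt0 // lnlb1 lnlb lnl lnq lnN lnM // nm NA /q NA /l.
(* These arguments may be 0, so their logarithms stay atoms. *)
set X := ln (1 - _); set Y := ln (1 - _); set Z := ln (_ - _).
by field; rewrite !nz.
Qed.

(** * Combining the capacity bound with the Newton inequalities *)

Section Main.
Variables (a b : nat) (TA TB : finType) (E : TA -> TB -> bool) (k : nat).
Hypotheses (b0 : (0 < b)%N) (ba : (b <= a)%N).
Hypothesis degA : forall x : TA, #|[set y : TB | E x y]| = a.
Hypothesis degB : forall y : TB, #|[set x : TA | E x y]| = b.
Hypotheses (k0 : (0 < k)%N) (kn : (k <= #|TA|)%N).
Local Notation n := #|TA|.
Local Notation m := #|TB|.

Lemma biregular_edges : (n * a = m * b)%N.
Proof.
have -> : (n * a = \sum_(x : TA) \sum_(y | E x y) 1)%N.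
  rewrite -sum_nat_const; apply: eq_bigr => x _.
  by rewrite -(degA x) sum1_card; apply: eq_card => y; rewrite inE.
rewrite (exchange_big_dep xpredT) //= -sum_nat_const; apply: eq_bigr => y _.
by rewrite -(degB y) sum1_card; apply: eq_card => x; rewrite inE.
Qed.

Lemma num_matchings_ge (q := k%:R / n%:R : R) (l := k%:R / m%:R : R) :
  'C(n, k)%:R * q ^+ k * (1 - q) ^+ (n - k) *
    exp (m%:R * ((b%:R - l) * (ln (b%:R - l) - ln b%:R) - (1 - l) * ln (1 - l))
      + k%:R * (ln a%:R - ln q) - (n - k)%:R * ln (1 - q))
  <= (num_matchings E k)%:R.
Proof.
have a0 : (0 < a)%N by apply: leq_trans ba.
have edges := biregular_edges.
have nm : (n <= m)%N.
  by rewrite -(leq_pmul2r b0) -edges leq_mul2l ba orbT.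
have n0 : (0 < n)%N := leq_trans k0 kn.
have N0 : 0 < n%:R :> R by rewrite ltr0n.
have M0 : 0 < m%:R :> R by rewrite ltr0n (leq_trans n0).
have A0 : 0 < a%:R :> R by rewrite ltr0n.
have B0 : 0 < b%:R :> R by rewrite ltr0n.
have K0 : 0 < k%:R :> R by rewrite ltr0n.
have q0 : 0 < q by rewrite divr_gt0.
have q1 : q <= 1 by rewrite ler_pdivrMr // mul1r ler_nat.
have l0 : 0 < l by rewrite divr_gt0.
have l1 : l <= 1 by rewrite ler_pdivrMr // mul1r ler_nat (leq_trans kn).
have lE : l = q * b%:R / a%:R.
  have NA : n%:R = m%:R * b%:R / a%:R :> R by rewrite -natrM -edges natrM mulfK ?gt_eqF.
  by rewrite /l /q NA; field; rewrite !gt_eqF.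
set d := _ + _ - _.
have [p [p0 mE posp newt]] := num_matchings_Newton E (R : realFieldType).
have nk : (n - k < n)%N by rewrite -subn_gt0 subKn.
have mk : (num_matchings E k)%:R = 'C(n, k)%:R * p (n - k)%N :> R.
  by rewrite -(bin_sub kn) -mE ?leq_subr // subKn.
rewrite mk -!mulrA ler_wpM2l // mulrC [X in X * _]mulrC.
have -> : 1 - q = (n - k)%:R / n%:R by rewrite natrB // mulrBl divff ?gt_eqF.
(* The index is [n - k] because [m_k] is the coefficient of [z ^+ (n - k)]. *)
have := @coef_ge_binomial R p n (n - k) (exp d) nk (ltW (exp_gt0 d)) p0 posp newt.
rewrite subKn // => H; apply: H => z z0.
have -> : exp d * z ^+ (n - k) = exp (d + (n - k)%:R * ln z).
  by rewrite [RHS]expD; congr (_ * _); rewrite -{1}(exp_lnK z0) expRX mulr_natl.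
have := @mpart_capacity a b TA TB E a0 b0 degA degB q z l q0 q1 z0 l0 l1 lE
  (enum TB) [::] (fun=> 0).
rewrite cats0 => /(_ (perm_refl _)).
rewrite big_nil mulr0 addr0 -cardE.
rewrite (@eq_mpart _ _ E _ _ (fun=> z)); last by move=> i; rewrite big_nil; exact: addr0.
rewrite mpart_num_matchings (reindex_inj rev_ord_inj) /=.
rewrite (eq_bigr (fun j : 'I_n.+1 => 'C(n, j)%:R * p j * z ^+ j)); last first.
  by move=> j _; rewrite subSS mE -1?ltnS // subKn // -ltnS.
(* Since [n * q = k], the term [n * c] supplies [(n - k) * ln z] and the last two terms of [d]. *)
apply: le_trans; rewrite le_eqVlt; apply/orP; left; apply/eqP; congr exp.
by rewrite /d natrB // /q; field; rewrite gt_eqF.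
Qed.
End Main.
End Analysis.

Local Close Scope ring_scope.
(* The key [R] was taken over by [ring_scope]. *)
Delimit Scope R_scope with R.

Theorem theorem1p7 (a b : nat) (TA TB : finType) (E : TA -> TB -> bool) (k : nat) :
  (0 < b)%N -> (b <= a)%N ->
  (forall x : TA, #|[set y : TB | E x y]| = a) ->
  (forall y : TB, #|[set x : TA | E x y]| = b) ->
  (k <= #|TA|)%N ->
  let v := INR (#|TA| + #|TB|) in
  let p := (2 * INR k / v)%R in
  let q := ((INR a + INR b) / (2 * INR b) * p)%R in
  let pmu := (INR 'C(#|TA|, k) * pow q k * pow (1 - q) (#|TA| - k))%R in
  (pmu * exp (v * Gab a b p) <= INR (num_matchings E k))%R.
Proof.
move=> b0 ba degA degB kn v p q pmu.
(* For [k = 0] both sides are 1; the capacity argument takes [q > 0]. *)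
have [k0|k0] := posnP k.
  have p0 : p = 0%R by rewrite /p k0 /= Rmult_0_r /Rdiv Rmult_0_l.
  have q0 : q = 0%R by rewrite /q p0 Rmult_0_r.
  have H0 : Hent 0 = 0%R by rewrite /Hent; case: (RIneq.Req_dec_T 0 0).
  rewrite /pmu q0 p0 k0 num_matchings0 /Gab !Rmult_0_r Rmult_0_l H0 bin0 Rminus_0_r pow1 /=.
  rewrite !Rmult_0_r Rplus_0_r Rplus_0_r Rminus_0_r Rmult_0_r exp_0 !Rmult_1_r.
  exact: Rle_refl.
have a0 : (0 < a)%N by apply: leq_trans ba.
have edges := biregular_edges degA degB.
have nm : (#|TA| <= #|TB|)%N by rewrite -(leq_pmul2r b0) -edges leq_mul2l ba orbT.
apply/RleP; rewrite /pmu.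
have -> : (v * Gab a b p)%R = _ :=
  Gab_exponent a0 b0 edges k0 kn (leq_trans kn nm).
have -> : q = (INR k / INR #|TA|)%R.
  rewrite /q /p /v !INRE natrD.
  exact: (mean_parameter R k a0 b0 edges (leq_trans k0 kn)).
rewrite !RpowE !INRE.
exact: (num_matchings_ge b0 ba degA degB k0 kn).
Qed.
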